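(* The conjugate surface of the surface $\mathcal{C}_0$ in $\mathbb{H}^2\times\mathbb{R}$ is the helicoid $\mathcal{H}_1$ in $\mathbb{H}^2\times\mathbb{R}$.
   Context: $\mathbb{H}^2=\{(x^0,x^1,x^2): -(x^0)^2+(x^1)^2+(x^2)^2=-1,\ x^0>0\}$ in Lorentz space $\mathbb{L}^3$ with form $-(dx^0)^2+(dx^1)^2+(dx^2)^2$, and $\mathbb{H}^2\times\mathbb{R}\subset\mathbb{L}^3\times\mathbb{R}$. Helicoid $\mathcal{H}_1$: the surface given by the conformal minimal immersion $$x(u,v)=(\cosh\varphi(u),\ \sinh\varphi(u)\cos v,\ \sinh\varphi(u)\sin v,\ v),$$ where $\varphi'^2=1+\sinh^2\varphi$, $\varphi''=\sinh\varphi\cosh\varphi$, $\varphi(0)=0$, $\varphi'>0$ (maximal solution), $v\in\mathbb{R}$, with unit normal $N=\frac{1}{\varphi'(u)}(0,\sin v,-\cos v,\sinh\varphi(u))$. Surface $\mathcal{C}_0$: the surface given by the conformal minimal embedding $$x(u,v)=\Big(\tfrac{v^2+1}{2\cos u}+\tfrac{\cos u}{2},\ \tfrac{v}{\cos u},\ \tfrac{v^2-1}{2\cos u}+\tfrac{\cos u}{2},\ u\Big),\qquad (u,v)\in(-\tfrac\pi2,\tfrac\pi2)\times\mathbb{R},$$ with the unit normal $N$ for which $(\partial_ux,\partial_vx,N)$ is direct (its $\frac{\partial}{\partial t}$-component is $\sin u$). In both cases $z=u+iv$ is the conformal coordinate. Conjugation: for a conformal minimal immersion $x:\Sigma\to\mathbb{M}^2\times\mathbb{R}$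 ($\mathbb{M}^2=\mathbb{S}^2$ or $\mathbb{H}^2$) of a simply connected Riemann surface with unit normal $N$, let $ds^2$ be the induced metric, $S$ the symmetric operator on $\Sigma$ with $dx(SX)=-\bar\nabla_XN$ ($\bar\nabla$ the connection of $\mathbb{M}^2\times\mathbb{R}$), $T$ the vector field on $\Sigma$ with $dx(T)$ equal to the tangential projection of $\frac{\partial}{\partial t}$ (the unit vector field of the factor $\mathbb{R}$), and $\nu=\langle N,\frac{\partial}{\partial t}\rangle$. Let $J$ be the rotation by $\frac\pi2$ on $T\Sigma$. The conjugate immersion of $x$ is the conformal minimal immersion of $\Sigma$ whose corresponding data are $(ds^2,JS,JT,\nu)$; it is well defined up to isometries of $\mathbb{M}^2\times\mathbb{R}$ preserving the orientations of both $\mathbb{M}^2$ and $\mathbb{R}$, and conjugate surfaces are considered up to such isometries. The surface it parametrizes is the conjugate surface. The unit normals are the ones for which $(dx(e_1),dx(e_2),N)$ is direct for direct frames $(e_1,e_2)$ of $\Sigma$. Orientation: $\mathbb{M}^2\times\mathbb{R}$ is oriented so that a frame $(a,b,c)$ tangent at a point $p=(p^0,p^1,p^2,t)$ is direct when $(\bar N,a,b,c)$, with $\bar N=(p^0,p^1,p^2,0)$, has positive determinant in the canonical coordinates. *)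

(* Defs.v *)
From Stdlib Require Import Reals.
From Coquelicot Require Import Coquelicot.
Open Scope R_scope.

(** * Functions of two real variables on a domain of the (u,v)-plane *)

Definition domain := R -> R -> Prop.

Definition Du (f : R -> R -> R) (u v : R) : R := Derive (fun s => f s v) u.
Definition Dv (f : R -> R -> R) (u v : R) : R := Derive (fun s => f u s) v.

Fixpoint Ck (k : nat) (U : domain) (f : R -> R -> R) : Prop :=
  match k with
  | O => forall u v, U u v -> continuity_2d_pt f u v
  | S k' =>
      (forall u v, U u v ->
         ex_derive (fun s => f s v) u /\ ex_derive (fun s => f u s) v) /\
      Ck k' U (Du f) /\ Ck k' U (Dv f)
  end.

Definition smooth (U : domain) (f : R -> R -> R) : Prop := forall k, Ck k U f.

(** * The ambient space L^3 x R *)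

(* Vector operations are those of Coquelicot's product modules. *)
Definition L3 : Type := (R * R * R)%type.
Definition L3R : Type := (L3 * R)%type.

Definition c0 (a : L3) : R := fst (fst a).
Definition c1 (a : L3) : R := snd (fst a).
Definition c2 (a : L3) : R := snd a.

Definition lorentz (a b : L3) : R :=
  - (c0 a * c0 b) + c1 a * c1 b + c2 a * c2 b.

Definition inner (a b : L3R) : R :=
  lorentz (fst a) (fst b) + snd a * snd b.

Definition det3 (a b c : L3) : R :=
  c0 a * (c1 b * c2 c - c2 b * c1 c)
  - c1 a * (c0 b * c2 c - c2 b * c0 c)
  + c2 a * (c0 b * c1 c - c1 b * c0 c).

(* Laplace expansion along the column of t-coordinates. *)
Definition det4 (a b c d : L3R) : R :=
  - (snd a * det3 (fst b) (fst c) (fst d))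
  + snd b * det3 (fst a) (fst c) (fst d)
  - snd c * det3 (fst a) (fst b) (fst d)
  + snd d * det3 (fst a) (fst b) (fst c).

Definition hyperboloid (p : L3) : Prop := lorentz p p = -1 /\ 0 < c0 p.

Definition H2xR (p : L3R) : Prop := hyperboloid (fst p).

(* The normal of H^2 x R in L^3 x R; it satisfies <Nbar, Nbar> = -1. *)
Definition Nbar (p : L3R) : L3R := (fst p, 0).

Definition dt : L3R := ((0, 0, 0), 1).

(** * Isometries of H^2 x R preserving the orientations of both factors *)

(* Isometries of the hyperboloid model are the restrictions of the linear
   isometries of L^3 that preserve the sheet. A frame (a,b) of T_p H^2 is
   direct when det3 p a b > 0, so the orientation is preserved exactly when
   the linear map has positive determinant. *)
Definition direct_isometry_H2 (A : L3 -> L3) : Prop :=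
  (forall a b : L3, A (plus a b) = plus (A a) (A b)) /\
  (forall (r : R) (a : L3), A (scal r a) = scal r (A a)) /\
  (forall a b, lorentz (A a) (A b) = lorentz a b) /\
  (forall p, hyperboloid p -> hyperboloid (A p)) /\
  0 < det3 (A (1, 0, 0)) (A (0, 1, 0)) (A (0, 0, 1)).

Definition act (A : L3 -> L3) (c : R) (p : L3R) : L3R := (A (fst p), snd p + c).

(* The differential of [act A c], for A linear. *)
Definition d_act (A : L3 -> L3) (w : L3R) : L3R := (A (fst w), snd w).

(** * Maps from a plane domain to L^3 x R *)

Definition space_map : Type := R -> R -> L3R.

Definition smooth_map (U : domain) (x : space_map) : Prop :=
  smooth U (fun u v => c0 (fst (x u v))) /\
  smooth U (fun u v => c1 (fst (x u v))) /\
  smooth U (fun u v => c2 (fst (x u v))) /\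
  smooth U (fun u v => snd (x u v)).

Definition partial (D : (R -> R -> R) -> R -> R -> R) (x : space_map) : space_map :=
  fun u v =>
    ((D (fun s t => c0 (fst (x s t))) u v,
      D (fun s t => c1 (fst (x s t))) u v,
      D (fun s t => c2 (fst (x s t))) u v),
     D (fun s t => snd (x s t)) u v).

(* Tangent vectors of the domain, in the frame (d/du, d/dv). *)
Definition tangent : Type := (R * R)%type.

(* The derivative of x in the direction X, i.e. dx(X). *)
Definition diff (x : space_map) (u v : R) (X : tangent) : L3R :=
  plus (scal (fst X) (partial Du x u v)) (scal (snd X) (partial Dv x u v)).

(* Levi-Civita derivative of a vector field V along x: the component tangent to
   H^2 x R of the flat derivative. The sign is + since <Nbar, Nbar> = -1. *)
Definition nabla_bar (x V : space_map) (u v : R) (X : tangent) : L3R :=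
  plus (diff V u v X)
       (scal (inner (diff V u v X) (Nbar (x u v))) (Nbar (x u v))).

Definition direct_unit_normal (U : domain) (x N : space_map) : Prop :=
  smooth_map U N /\
  forall u v, U u v ->
    inner (N u v) (Nbar (x u v)) = 0 /\
    (forall X, inner (N u v) (diff x u v X) = 0) /\
    inner (N u v) (N u v) = 1 /\
    0 < det4 (Nbar (x u v)) (partial Du x u v) (partial Dv x u v) (N u v).

(** * The data (ds^2, S, T, nu) and conjugation *)

Record surface_data := SurfaceData {
  metric : R -> R -> tangent -> tangent -> R;
  shape  : R -> R -> tangent -> tangent;
  vert   : R -> R -> tangent;
  angle  : R -> R -> R
}.

Definition has_data (U : domain) (x N : space_map) (D : surface_data) : Prop :=
  forall u v, U u v ->
    (forall X Y, metric D u v X Y = inner (diff x u v X) (diff x u v Y)) /\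
    (forall X, diff x u v (shape D u v X) = opp (nabla_bar x N u v X)) /\
    (forall X Y, metric D u v (shape D u v X) Y = metric D u v X (shape D u v Y)) /\
    (forall X, inner (minus dt (diff x u v (vert D u v))) (diff x u v X) = 0) /\
    angle D u v = inner (N u v) dt.

(* Positivity of the conformal factor makes x an immersion. Minimality is the
   vanishing of the trace of the shape operator. *)
Definition conformal_minimal_immersion (U : domain) (x N : space_map) : Prop :=
  smooth_map U x /\
  direct_unit_normal U x N /\
  (forall u v, U u v -> H2xR (x u v)) /\
  (forall u v, U u v -> exists lambda : R, 0 < lambda /\
     forall X Y : tangent, inner (diff x u v X) (diff x u v Y)
                  = lambda * (fst X * fst Y + snd X * snd Y)) /\
  (exists D, has_data U x N D /\
     forall u v, U u v ->
       fst (shape D u v (1, 0)) + snd (shape D u v (0, 1)) = 0).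

(* Rotation by pi/2, z = u + i v being a conformal coordinate. *)
Definition J (X : tangent) : tangent := (- snd X, fst X).

Definition conjugate_data (D : surface_data) : surface_data :=
  SurfaceData (metric D)
              (fun u v X => J (shape D u v X))
              (fun u v => J (vert D u v))
              (angle D).

(* (y, M) is a conjugate immersion of (x, N), for a simply connected open
   domain U with conformal coordinate z = u + i v. *)
Definition conjugate_immersion (U : domain) (x N y M : space_map) : Prop :=
  conformal_minimal_immersion U x N /\
  conformal_minimal_immersion U y M /\
  exists D, has_data U x N D /\ has_data U y M (conjugate_data D).

Definition diffeomorphism (U V : domain) (f1 f2 : R -> R -> R) : Prop :=
  smooth U f1 /\ smooth U f2 /\
  (forall u v, U u v -> V (f1 u v) (f2 u v)) /\
  exists g1 g2 : R -> R -> R,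
    smooth V g1 /\ smooth V g2 /\
    (forall u v, V u v -> U (g1 u v) (g2 u v)) /\
    (forall u v, U u v ->
       g1 (f1 u v) (f2 u v) = u /\ g2 (f1 u v) (f2 u v) = v) /\
    (forall u v, V u v ->
       f1 (g1 u v) (g2 u v) = u /\ f2 (g1 u v) (g2 u v) = v).

(* The surfaces with normal parametrized by (x, N) on U and (y, M) on V agree,
   after reparametrization, up to an isometry of H^2 x R preserving the
   orientations of both factors. *)
Definition congruent_surfaces
    (U : domain) (x N : space_map) (V : domain) (y M : space_map) : Prop :=
  exists (A : L3 -> L3) (c : R) (f1 f2 : R -> R -> R),
    direct_isometry_H2 A /\
    diffeomorphism U V f1 f2 /\
    forall u v, U u v ->
      y (f1 u v) (f2 u v) = act A c (x u v) /\
      M (f1 u v) (f2 u v) = d_act A (N u v).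

(* The conjugate immersion exists, and every choice of it parametrizes the
   surface (V, y, M). The normals N of x and M' of y' are determined by x and
   y', being direct. *)
Definition is_conjugate_surface
    (U : domain) (x : space_map) (V : domain) (y M : space_map) : Prop :=
  (exists N y' M', conjugate_immersion U x N y' M') /\
  (forall N y' M', conjugate_immersion U x N y' M' ->
     congruent_surfaces U y' M' V y M).

(** * The surface C_0 *)

Definition C0_domain : domain := fun u v => - (PI / 2) < u < PI / 2.

Definition C0 : space_map := fun u v =>
  (((v ^ 2 + 1) / (2 * cos u) + cos u / 2,
    v / cos u,
    (v ^ 2 - 1) / (2 * cos u) + cos u / 2),
   u).

(** * The helicoid H_1 *)

Definition in_interval (a b : Rbar) (u : R) : Prop :=
  Rbar_lt a (Finite u) /\ Rbar_lt (Finite u) b.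

Definition profile_solution (a b : Rbar) (phi : R -> R) : Prop :=
  in_interval a b 0 /\
  phi 0 = 0 /\
  forall u, in_interval a b u ->
    ex_derive phi u /\ ex_derive (Derive phi) u /\
    0 < Derive phi u /\
    Derive phi u ^ 2 = 1 + sinh (phi u) ^ 2 /\
    Derive (Derive phi) u = sinh (phi u) * cosh (phi u).

Definition maximal_profile (a b : Rbar) (phi : R -> R) : Prop :=
  profile_solution a b phi /\
  forall (a' b' : Rbar) (psi : R -> R),
    profile_solution a' b' psi ->
    Rbar_le a' a -> Rbar_le b b' ->
    (forall u, in_interval a b u -> psi u = phi u) ->
    a' = a /\ b' = b.

Definition helicoid_domain (a b : Rbar) : domain := fun u v => in_interval a b u.

Definition helicoid (phi : R -> R) : space_map := fun u v =>
  ((cosh (phi u), sinh (phi u) * cos v, sinh (phi u) * sin v), v).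

Definition helicoid_normal (phi : R -> R) : space_map := fun u v =>
  ((0, sin v / Derive phi u, - cos v / Derive phi u),
   sinh (phi u) / Derive phi u).

(* Main.v *)
(** Solving the profile equation shows that [atan (sinh phi)] is the identity,
    so the maximal profile lives on [(-pi/2, pi/2)], with [sinh phi = tan] and
    [cosh phi = sec]; hence the helicoid and [C0] are parametrized by the same
    strip. There the data of [C0] are [ds^2 = (du^2 + dv^2) / cos^2 u],
    [S = diag(- cos u, cos u)], [T = cos^2 u d/du], [nu = sin u], and those of
    the helicoid are obtained by applying [J] to [S] and [T].

    Any other immersion [(p, t)] with normal [(m, sin u)] and the data of the
    helicoid has [t = v] up to a constant. Moreover [p], [p_u] and [m] satisfy
    a closed linear first-order system with coefficients in [u], and
    [(p, cos u p_u, - m / cos u)] is an orthonormal frame of [L^3]. Solving the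
    system exhibits [p] and [m] as the helicoid expressed in the frame at the
    origin, and passing to coordinates in that frame is the isometry sought. *)

Require Import Defs.
From Stdlib Require Import Reals Lra.
From Coquelicot Require Import Coquelicot.
Open Scope R_scope.

(* Gives the coordinate [c1] of [Defs] priority over the one of [Reals]. *)
Import Defs.

(** * The strip and the profile curve *)

Lemma C0_domain_open u v : C0_domain u v -> locally_2d C0_domain u v.
Proof.
  intros [h1 h2].
  assert (hd : 0 < Rmin (u + PI / 2) (PI / 2 - u)) by (apply Rmin_pos; lra).
  exists (mkposreal _ hd); simpl; intros s t hs _.
  pose proof (Rmin_l (u + PI / 2) (PI / 2 - u)).
  pose proof (Rmin_r (u + PI / 2) (PI / 2 - u)).
  apply Rabs_def2 in hs; split; lra.
Qed.

Lemma cos_strip_pos u v : C0_domain u v -> 0 < cos u.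
Proof. intros [h1 h2]; apply cos_gt_0; lra. Qed.

Lemma Du_ext_strip f g u v :
  (forall s t, C0_domain s t -> f s t = g s t) -> C0_domain u v ->
  Du f u v = Du g u v.
Proof.
  intros hfg hU; apply Derive_ext_loc.
  generalize (locally_2d_1d_const_y _ _ _ (C0_domain_open u v hU)).
  apply filter_imp; intros s; apply hfg.
Qed.

Lemma Dv_ext_strip f g u v :
  (forall s t, C0_domain s t -> f s t = g s t) -> C0_domain u v ->
  Dv f u v = Dv g u v.
Proof. intros hfg hU; apply Derive_ext; intros t; apply hfg, hU. Qed.

(** The strip is open, so agreement on it passes to both partial derivatives and the induction
    applies to them. This is needed because the symbolic derivatives below are the true ones only
    where [cos u] is nonzero. *)
Lemma Ck_ext_strip k : forall f g,
  (forall u v, C0_domain u v -> f u v = g u v) ->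
  Ck k C0_domain f -> Ck k C0_domain g.
Proof.
  induction k as [|k IH]; intros f g hfg; simpl.
  - intros hf u v hU.
    apply continuity_2d_pt_ext_loc with f; [|now apply hf].
    destruct (C0_domain_open u v hU) as [d hd].
    exists d; intros s t hs ht; apply hfg, hd; assumption.
  - intros (hf & hu & hv); split; [|split].
    + intros u v hU; destruct (hf u v hU) as [h1 h2]; split.
      * apply ex_derive_ext_loc with (fun s => f s v); [|exact h1].
        generalize (locally_2d_1d_const_y _ _ _ (C0_domain_open u v hU)).
        apply filter_imp; intros s; apply hfg.
      * apply ex_derive_ext with (fun s => f u s); [|exact h2].
        intros t; apply hfg, hU.
    + apply IH with (Du f); [|exact hu].
      intros u v hU; now apply Du_ext_strip.
    + apply IH with (Dv f); [|exact hv].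
      intros u v hU; now apply Dv_ext_strip.
Qed.

(* Smoothness of concrete coordinate functions is proved by reflection: this
   class of expressions is closed under the two partial derivatives. *)
Inductive expr : Type :=
  | Cst (r : R) | U_ | V_ | CosU | SinU | SecU | CosV | SinV
  | Add (e1 e2 : expr) | Mul (e1 e2 : expr).

Fixpoint eval (e : expr) (u v : R) : R :=
  match e with
  | Cst r => r | U_ => u | V_ => v
  | CosU => cos u | SinU => sin u | SecU => / cos u
  | CosV => cos v | SinV => sin v
  | Add e1 e2 => eval e1 u v + eval e2 u v
  | Mul e1 e2 => eval e1 u v * eval e2 u v
  end.

(** The rule for [SecU] is $(1/\cos)'=\sin/\cos^2$, so no inverse other than [SecU] ever arises. The
    default case covers constants and the functions of $v$ alone. *)
Fixpoint deru (e : expr) : expr :=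
  match e with
  | U_ => Cst 1
  | CosU => Mul (Cst (-1)) SinU | SinU => CosU
  | SecU => Mul SinU (Mul SecU SecU)
  | Add e1 e2 => Add (deru e1) (deru e2)
  | Mul e1 e2 => Add (Mul (deru e1) e2) (Mul e1 (deru e2))
  | _ => Cst 0
  end.

Fixpoint derv (e : expr) : expr :=
  match e with
  | V_ => Cst 1
  | CosV => Mul (Cst (-1)) SinV | SinV => CosV
  | Add e1 e2 => Add (derv e1) (derv e2)
  | Mul e1 e2 => Add (Mul (derv e1) e2) (Mul e1 (derv e2))
  | _ => Cst 0
  end.

Lemma is_derive_eval_u e u v : C0_domain u v ->
  is_derive (fun s => eval e s v) u (eval (deru e) u v).
Proof.
  intros hU; pose proof (cos_strip_pos u v hU) as hc.
  induction e; simpl;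
    try (auto_derive; [lra || exact I | try field; lra]).
  - apply (is_derive_plus (fun s => eval e1 s v) (fun s => eval e2 s v));
      assumption.
  - apply (is_derive_mult (fun s => eval e1 s v) (fun s => eval e2 s v));
      try assumption; exact Rmult_comm.
Qed.

Lemma is_derive_eval_v e u v : is_derive (eval e u) v (eval (derv e) u v).
Proof.
  induction e; simpl; try (auto_derive; [exact I | ring]).
  - apply (is_derive_plus (eval e1 u) (eval e2 u)); assumption.
  - apply (is_derive_mult (eval e1 u) (eval e2 u));
      try assumption; exact Rmult_comm.
Qed.

Lemma continuity_2d_eval e u v : C0_domain u v ->
  continuity_2d_pt (eval e) u v.
Proof.
  intros hU; pose proof (cos_strip_pos u v hU) as hc.
  induction e; simpl.
  - apply continuity_2d_pt_const.
  - apply continuity_2d_pt_id1.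
  - apply continuity_2d_pt_id2.
  - apply (continuity_1d_2d_pt_comp cos (fun x _ => x));
      [apply continuity_cos | apply continuity_2d_pt_id1].
  - apply (continuity_1d_2d_pt_comp sin (fun x _ => x));
      [apply continuity_sin | apply continuity_2d_pt_id1].
  - apply (continuity_2d_pt_inv (fun x _ => cos x)); [|lra].
    apply (continuity_1d_2d_pt_comp cos (fun x _ => x));
      [apply continuity_cos | apply continuity_2d_pt_id1].
  - apply (continuity_1d_2d_pt_comp cos (fun _ y => y));
      [apply continuity_cos | apply continuity_2d_pt_id2].
  - apply (continuity_1d_2d_pt_comp sin (fun _ y => y));
      [apply continuity_sin | apply continuity_2d_pt_id2].
  - apply continuity_2d_pt_plus; assumption.
  - apply continuity_2d_pt_mult; assumption.
Qed.

Lemma Ck_eval k : forall e, Ck k C0_domain (eval e).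
Proof.
  induction k as [|k IH]; intros e; simpl.
  - intros u v; apply continuity_2d_eval.
  - split; [|split].
    + intros u v hU; split; eexists.
      * now apply is_derive_eval_u.
      * apply is_derive_eval_v.
    + apply Ck_ext_strip with (eval (deru e)); [|apply IH].
      intros u v hU; symmetry; apply is_derive_unique.
      now apply is_derive_eval_u.
    + apply Ck_ext_strip with (eval (derv e)); [|apply IH].
      intros u v hU; symmetry; apply is_derive_unique.
      apply is_derive_eval_v.
Qed.

Lemma smooth_eval e f : (forall u v, C0_domain u v -> f u v = eval e u v) ->
  smooth C0_domain f.
Proof.
  intros h k; apply Ck_ext_strip with (eval e); [|apply Ck_eval].
  intros u v hU; symmetry; now apply h.
Qed.

(** * The profile equation and its maximal solution *)

Lemma is_derive_eq (f : R -> R) (x l l' : R) :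
  is_derive f x l -> l = l' -> is_derive f x l'.
Proof. intros h <-; exact h. Qed.

Lemma is_derive_sinh x : is_derive sinh x (cosh x).
Proof. apply is_derive_Reals, derivable_pt_lim_sinh. Qed.

Lemma cosh_sqr x : cosh x ^ 2 = 1 + sinh x ^ 2.
Proof.
  unfold cosh, sinh.
  assert (h : exp x * exp (- x) = 1).
  { rewrite <- exp_plus; replace (x + - x) with 0 by ring; apply exp_0. }
  nra.
Qed.

Lemma cosh_pos x : 0 < cosh x.
Proof. unfold cosh; pose proof (exp_pos x); pose proof (exp_pos (- x)); lra. Qed.

Lemma in_interval_between a b s t u :
  in_interval a b s -> in_interval a b t -> s <= u <= t -> in_interval a b u.
Proof.
  intros [h1 _] [_ h2] [h3 h4]; split.
  - now apply Rbar_lt_le_trans with (Finite s).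
  - now apply Rbar_le_lt_trans with (Finite t).
Qed.

(** Both sides are positive and have the same square $1+\sinh^2\varphi$. *)
Lemma profile_derive a b phi u : profile_solution a b phi ->
  in_interval a b u -> Derive phi u = cosh (phi u).
Proof.
  intros (_ & _ & h) hu; destruct (h u hu) as (_ & _ & hp & hs & _).
  rewrite <- cosh_sqr in hs; pose proof (cosh_pos (phi u)); nra.
Qed.

(* The function [atan (sinh phi)] has derivative 1. *)
Lemma profile_gudermannian a b phi u : profile_solution a b phi ->
  in_interval a b u -> atan (sinh (phi u)) = u.
Proof.
  intros hphi hu; pose proof hphi as (h0 & hphi0 & h).
  assert (hd : forall s, in_interval a b s ->
            is_derive (fun s => atan (sinh (phi s)) - s) s zero).
  { intros s hs.
    assert (hp : is_derive phi s (cosh (phi s))).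
    { rewrite <- (profile_derive a b phi s hphi hs).
      apply Derive_correct, h, hs. }
    pose proof (is_derive_comp sinh phi s _ _ (is_derive_sinh _) hp) as h1.
    pose proof (is_derive_comp atan _ s _ _ (is_derive_atan _) h1) as h2.
    pose proof (is_derive_minus _ _ s _ _ h2 (is_derive_id s)) as h3.
    apply is_derive_eq with (1 := h3).
    cbv -[Rplus Rmult Ropp Rinv IZR cosh sinh].
    pose proof (cosh_sqr (phi s)) as hs2.
    replace (cosh (phi s) * cosh (phi s)) with (1 + sinh (phi s) * sinh (phi s))
      by nra.
    field; nra. }
  assert (h00 : atan (sinh (phi 0)) - 0 = 0)
    by (rewrite hphi0, sinh_0, atan_0; ring).
  destruct (Rtotal_order u 0) as [hlt | [-> | hgt]]; [| lra |].
  - assert (e := eq_is_derive (fun s => atan (sinh (phi s)) - s) u 0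
      (fun t ht => hd t (in_interval_between a b u 0 t hu h0 ht)) hlt).
    simpl in e; lra.
  - assert (e := eq_is_derive (fun s => atan (sinh (phi s)) - s) 0 u
      (fun t ht => hd t (in_interval_between a b 0 u t h0 hu ht)) hgt).
    simpl in e; lra.
Qed.

(** The inverse Gudermannian function solves the profile equation on all of $(-\pi/2,\pi/2)$; it is
    the competitor to which maximality is applied. *)
Lemma tan_profile_solution :
  profile_solution (Finite (- (PI / 2))) (Finite (PI / 2))
    (fun u => arcsinh (tan u)).
Proof.
  assert (hpi := PI_RGT_0).
  assert (hd : forall u, - (PI / 2) < u < PI / 2 ->
    is_derive (fun u => arcsinh (tan u)) u (/ cos u)).
  { intros u hu.
    assert (hc : 0 < cos u) by (apply cos_gt_0; lra).
    assert (h1 : is_derive tan u (tan u ^ 2 + 1)) by (apply is_derive_tan; lra).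
    assert (h2 : is_derive arcsinh (tan u) (/ sqrt (tan u ^ 2 + 1)))
      by (apply is_derive_Reals, derivable_pt_lim_arcsinh).
    pose proof (is_derive_comp arcsinh tan u _ _ h2 h1) as h3.
    apply is_derive_eq with (1 := h3).
    (* The square root in the derivative of [arcsinh] is thus $\sec u$, which cancels one factor of
       $\tan'=\sec^2$. *)
    assert (e : tan u ^ 2 + 1 = (/ cos u) ^ 2).
    { pose proof (sin2_cos2 u) as e; unfold Rsqr in e; unfold tan.
      field_simplify_eq; [nra|lra]. }
    rewrite e, sqrt_pow2 by (left; apply Rinv_0_lt_compat, hc).
    unfold scal; simpl; unfold mult; simpl; field; lra. }
  split; [|split].
  - split; simpl; lra.
  - now rewrite tan_0, arcsinh_0.
  - intros u [hu1 hu2]; simpl in hu1, hu2.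
    assert (hu : - (PI / 2) < u < PI / 2) by lra.
    assert (hc : 0 < cos u) by (apply cos_gt_0; lra).
    assert (e1 : Derive (fun u => arcsinh (tan u)) u = / cos u)
      by (apply is_derive_unique; auto).
    assert (e2 : is_derive (Derive (fun u => arcsinh (tan u))) u
                   (sin u * / cos u ^ 2)).
    (* The first derivative is known to be the secant on the strip only, so it is replaced near
       [u]. *)
    { apply is_derive_ext_loc with (fun u => / cos u).
      - generalize (locally_2d_1d_const_y _ _ _ (C0_domain_open u 0 hu)).
        apply filter_imp; intros s hs.
        symmetry; apply is_derive_unique; auto.
      - auto_derive; [lra | field; lra]. }
    assert (e3 : cosh (arcsinh (tan u)) = / cos u).
    { pose proof (cosh_sqr (arcsinh (tan u))) as h.
      rewrite sinh_arcsinh in h.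
      pose proof (cosh_pos (arcsinh (tan u))).
      assert (0 < / cos u) by now apply Rinv_0_lt_compat.
      assert (e : 1 + tan u ^ 2 = (/ cos u) ^ 2).
      { pose proof (sin2_cos2 u) as e; unfold Rsqr in e; unfold tan.
        field_simplify_eq; [nra|lra]. }
      nra. }
    split; [eexists; eauto|]; split; [eexists; eauto|].
    rewrite e1, (is_derive_unique _ _ _ e2), <- cosh_sqr, e3, sinh_arcsinh.
    split; [now apply Rinv_0_lt_compat|]; split; [reflexivity|].
    unfold tan; field; lra.
Qed.

(** By [profile_gudermannian], the bound on [atan] puts the interval inside $(-\pi/2,\pi/2)$. There
    [phi] is a restriction of the explicit solution, and maximality forces the endpoints to
    agree. *)
Lemma maximal_profile_interval a b phi : maximal_profile a b phi ->
  a = Finite (- (PI / 2)) /\ b = Finite (PI / 2).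
Proof.
  intros [hs hm].
  assert (hin : forall u, in_interval a b u -> - (PI / 2) < u < PI / 2).
  { intros u hu; rewrite <- (profile_gudermannian a b phi u hs hu).
    pose proof (atan_bound (sinh (phi u))); lra. }
  pose proof hs as ([ha hb] & _).
  assert (hpi := PI_RGT_0).
  destruct (hm _ _ _ tan_profile_solution) as [e1 e2].
  (* If [a] were below $-\pi/2$, the point $-\pi/2$ would lie in the interval, against the strict
     bound [hin]. The other endpoint is symmetric. *)
  - apply Rbar_not_lt_le; intros h.
    destruct (hin (- (PI / 2))) as [h1 _]; [|lra].
    split; [exact h|]. apply Rbar_lt_trans with (Finite 0); [simpl; lra | exact hb].
  - apply Rbar_not_lt_le; intros h.
    destruct (hin (PI / 2)) as [_ h1]; [|lra].
    split; [|exact h]. apply Rbar_lt_trans with (Finite 0); [exact ha | simpl; lra].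
  - intros u hu.
    (* Writing $u=\arctan\sinh\varphi(u)$ on the left lets $\mathrm{arcsinh}\circ\tan$ collapse to
       [phi]. *)
    rewrite <- (profile_gudermannian a b phi u hs hu) at 1.
    now rewrite tan_atan, arcsinh_sinh.
  - auto.
Qed.

(** Taking [tan] of $\arctan\sinh\varphi=u$ gives the first value; the others follow from
    $\cosh^2=1+\sinh^2$, positivity and $\varphi'=\cosh\varphi$. *)
Lemma maximal_profile_values a b phi u v : maximal_profile a b phi ->
  C0_domain u v ->
  sinh (phi u) = sin u / cos u /\ cosh (phi u) = / cos u /\
  Derive phi u = / cos u.
Proof.
  intros hphi hU; destruct (maximal_profile_interval a b phi hphi) as [ea eb].
  destruct hphi as [hs _].
  assert (hin : in_interval a b u) by (subst a b; exact hU).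
  pose proof (cos_strip_pos u v hU) as hc.
  assert (e1 : sinh (phi u) = sin u / cos u).
  { pose proof (profile_gudermannian a b phi u hs hin) as e.
    apply (f_equal tan) in e; rewrite tan_atan in e; exact e. }
  assert (e2 : cosh (phi u) = / cos u).
  { pose proof (cosh_sqr (phi u)) as h; rewrite e1 in h.
    pose proof (cosh_pos (phi u)).
    assert (0 < / cos u) by now apply Rinv_0_lt_compat.
    assert (e : 1 + (sin u / cos u) ^ 2 = (/ cos u) ^ 2).
    { pose proof (sin2_cos2 u) as e; unfold Rsqr in e.
      field_simplify_eq; [nra|lra]. }
    nra. }
  split; [exact e1|]; split; [exact e2|].
  now rewrite (profile_derive a b phi u hs hin).
Qed.

(** * The data of C_0 and of the helicoid *)

Definition C0_normal : space_map := fun u v =>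
  (((cos u ^ 2 - v ^ 2 - 1) / 2, - v, (cos u ^ 2 - v ^ 2 + 1) / 2), sin u).

(* The helicoid with [cosh phi = sec u], [sinh phi = tan u] substituted. *)
Definition H1 : space_map := fun u v =>
  ((/ cos u, sin u / cos u * cos v, sin u / cos u * sin v), v).

Definition H1_normal : space_map := fun u v =>
  ((0, cos u * sin v, - cos u * cos v), sin u).

Lemma vector_eq (a b : L3R) :
  c0 (fst a) = c0 (fst b) -> c1 (fst a) = c1 (fst b) ->
  c2 (fst a) = c2 (fst b) -> snd a = snd b -> a = b.
Proof.
  destruct a as [[[a0 a1] a2] a3], b as [[[b0 b1] b2] b3].
  unfold c0, c1, c2; simpl; congruence.
Qed.

Ltac compute_partial hU :=
  pose proof (cos_strip_pos _ _ hU);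
  apply vector_eq; apply is_derive_unique;
  cbv [c0 c1 c2 C0 C0_normal H1 H1_normal fst snd];
  (auto_derive; [repeat split; lra | try field; lra]).

Lemma C0_Du u v : C0_domain u v -> partial Du C0 u v =
  ((sin u * (v ^ 2 + 1) / (2 * cos u ^ 2) - sin u / 2,
    v * sin u / cos u ^ 2,
    sin u * (v ^ 2 - 1) / (2 * cos u ^ 2) - sin u / 2), 1).
Proof. intros hU; compute_partial hU. Qed.

Lemma C0_Dv u v : C0_domain u v ->
  partial Dv C0 u v = ((v / cos u, / cos u, v / cos u), 0).
Proof. intros hU; compute_partial hU. Qed.

Lemma C0_normal_Du u v : C0_domain u v -> partial Du C0_normal u v =
  ((- cos u * sin u, 0, - cos u * sin u), cos u).
Proof. intros hU; compute_partial hU. Qed.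

Lemma C0_normal_Dv u v : C0_domain u v ->
  partial Dv C0_normal u v = ((- v, - (1), - v), 0).
Proof. intros hU; compute_partial hU. Qed.

Lemma H1_Du u v : C0_domain u v -> partial Du H1 u v =
  ((sin u / cos u ^ 2, (1 + sin u ^ 2 / cos u ^ 2) * cos v,
    (1 + sin u ^ 2 / cos u ^ 2) * sin v), 0).
Proof. intros hU; compute_partial hU. Qed.

Lemma H1_Dv u v : C0_domain u v -> partial Dv H1 u v =
  ((0, - (sin u / cos u * sin v), sin u / cos u * cos v), 1).
Proof. intros hU; compute_partial hU. Qed.

Lemma H1_normal_Du u v : C0_domain u v -> partial Du H1_normal u v =
  ((0, - sin u * sin v, sin u * cos v), cos u).
Proof. intros hU; compute_partial hU. Qed.

Lemma H1_normal_Dv u v : C0_domain u v -> partial Dv H1_normal u v =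
  ((0, cos u * cos v, cos u * sin v), 0).
Proof. intros hU; compute_partial hU. Qed.

Definition C0_data : surface_data := SurfaceData
  (fun u v X Y => / cos u ^ 2 * (fst X * fst Y + snd X * snd Y))
  (fun u v X => (- cos u * fst X, cos u * snd X))
  (fun u v => (cos u ^ 2, 0))
  (fun u v => sin u).

Ltac to_reals :=
  cbv -[Rplus Rmult Ropp Rinv Rdiv Rminus IZR sin cos pow Rlt].

Ltac expand_partials hU :=
  unfold nabla_bar, diff;
  rewrite ?(C0_Du _ _ hU), ?(C0_Dv _ _ hU), ?(C0_normal_Du _ _ hU),
    ?(C0_normal_Dv _ _ hU), ?(H1_Du _ _ hU), ?(H1_Dv _ _ hU),
    ?(H1_normal_Du _ _ hU), ?(H1_normal_Dv _ _ hU);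
  to_reals.

(** With sines and cosines turned into variables and denominators cleared, each identity is
    polynomial modulo $\sin^2=1-\cos^2$. *)
Ltac trig_abstract u v :=
  let hu := fresh in let hv := fresh in
  let s := fresh "s" in let c := fresh "c" in
  let sv := fresh "sv" in let cv := fresh "cv" in
  assert (hu : sin u ^ 2 = 1 - cos u ^ 2)
    by (pose proof (sin2_cos2 u) as hu; unfold Rsqr in hu; lra);
  assert (hv : sin v ^ 2 = 1 - cos v ^ 2)
    by (pose proof (sin2_cos2 v) as hv; unfold Rsqr in hv; lra);
  set (s := sin u) in *; set (c := cos u) in *;
  set (sv := sin v) in *; set (cv := cos v) in *;
  clearbody s c sv cv;
  try (field_simplify_eq; try lra); ring [hu hv].

Ltac surface_identity hU :=
  lazymatch type of hU with C0_domain ?u ?v =>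
    pose proof (cos_strip_pos u v hU); expand_partials hU; trig_abstract u v
  end.

Lemma C0_has_data : has_data C0_domain C0 C0_normal C0_data.
Proof.
  intros u v hU; split; [|split; [|split; [|split]]].
  - intros [X1 X2] [Y1 Y2]. surface_identity hU.
  - intros [X1 X2]; apply vector_eq; surface_identity hU.
  - intros [X1 X2] [Y1 Y2]. surface_identity hU.
  - intros [X1 X2]. surface_identity hU.
  - surface_identity hU.
Qed.

Lemma H1_has_data :
  has_data C0_domain H1 H1_normal (conjugate_data C0_data).
Proof.
  intros u v hU; split; [|split; [|split; [|split]]].
  - intros [X1 X2] [Y1 Y2]. surface_identity hU.
  - intros [X1 X2]; apply vector_eq; surface_identity hU.
  - intros [X1 X2] [Y1 Y2]. surface_identity hU.
  - intros [X1 X2]. surface_identity hU.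
  - surface_identity hU.
Qed.

(** * Smoothness, direct normals and conjugacy of [C0] and [H1] *)

Ltac smooth_by e :=
  apply (smooth_eval e);
  let u := fresh "u" in let v := fresh "v" in let hU := fresh "hU" in
  intros u v hU; pose proof (cos_strip_pos u v hU);
  cbv [c0 c1 c2 C0 C0_normal H1 H1_normal fst snd eval]; try field; lra.

Lemma C0_smooth : smooth_map C0_domain C0.
Proof.
  split; [|split; [|split]].
  - smooth_by (Mul (Cst (1 / 2))
      (Add (Mul (Add (Mul V_ V_) (Cst 1)) SecU) CosU)).
  - smooth_by (Mul V_ SecU).
  - smooth_by (Mul (Cst (1 / 2))
      (Add (Mul (Add (Mul V_ V_) (Cst (-1))) SecU) CosU)).
  - smooth_by U_.
Qed.

Lemma C0_normal_smooth : smooth_map C0_domain C0_normal.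
Proof.
  split; [|split; [|split]].
  - smooth_by (Mul (Cst (1 / 2))
      (Add (Mul CosU CosU) (Add (Mul (Cst (-1)) (Mul V_ V_)) (Cst (-1))))).
  - smooth_by (Mul (Cst (-1)) V_).
  - smooth_by (Mul (Cst (1 / 2))
      (Add (Mul CosU CosU) (Add (Mul (Cst (-1)) (Mul V_ V_)) (Cst 1)))).
  - smooth_by SinU.
Qed.

Lemma H1_smooth : smooth_map C0_domain H1.
Proof.
  split; [|split; [|split]].
  - smooth_by SecU.
  - smooth_by (Mul (Mul SinU SecU) CosV).
  - smooth_by (Mul (Mul SinU SecU) SinV).
  - smooth_by V_.
Qed.

Lemma H1_normal_smooth : smooth_map C0_domain H1_normal.
Proof.
  split; [|split; [|split]].
  - smooth_by (Cst 0).
  - smooth_by (Mul CosU SinV).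
  - smooth_by (Mul (Cst (-1)) (Mul CosU CosV)).
  - smooth_by SinU.
Qed.

Lemma C0_direct_normal : direct_unit_normal C0_domain C0 C0_normal.
Proof.
  split; [exact C0_normal_smooth|].
  intros u v hU; split; [|split; [|split]].
  - surface_identity hU.
  - intros [X1 X2]; surface_identity hU.
  - surface_identity hU.
  - pose proof (cos_strip_pos u v hU).
    (* The determinant is the area density of the metric, the normal being a unit vector. *)
    replace (det4 _ _ _ _) with (/ cos u ^ 2) by surface_identity hU.
    apply Rinv_0_lt_compat; nra.
Qed.

Lemma H1_direct_normal : direct_unit_normal C0_domain H1 H1_normal.
Proof.
  split; [exact H1_normal_smooth|].
  intros u v hU; split; [|split; [|split]].
  - surface_identity hU.
  - intros [X1 X2]; surface_identity hU.
  - surface_identity hU.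
  - pose proof (cos_strip_pos u v hU).
    replace (det4 _ _ _ _) with (/ cos u ^ 2) by surface_identity hU.
    apply Rinv_0_lt_compat; nra.
Qed.

(** Conjugation keeps the metric, so one conformal factor $1/\cos^2u$ serves both [C0] and [H1]. *)
Lemma conformal_minimal_of_data x N D :
  smooth_map C0_domain x -> direct_unit_normal C0_domain x N ->
  (forall u v, C0_domain u v -> H2xR (x u v)) ->
  has_data C0_domain x N D -> metric D = metric C0_data ->
  (forall u v, C0_domain u v ->
     fst (shape D u v (1, 0)) + snd (shape D u v (0, 1)) = 0) ->
  conformal_minimal_immersion C0_domain x N.
Proof.
  intros hx hN hp hD hm htr.
  split; [exact hx|]; split; [exact hN|]; split; [exact hp|]; split.
  - intros u v hU; exists (/ cos u ^ 2).
    pose proof (cos_strip_pos u v hU).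
    split; [apply Rinv_0_lt_compat; nra|].
    intros X Y; destruct (hD u v hU) as [h _].
    now rewrite <- h, hm.
  - exists D; split; assumption.
Qed.

Lemma C0_H1_conjugate :
  conjugate_immersion C0_domain C0 C0_normal H1 H1_normal.
Proof.
  split; [|split].
  - apply conformal_minimal_of_data with C0_data.
    + exact C0_smooth.
    + exact C0_direct_normal.
    + intros u v hU; pose proof (cos_strip_pos u v hU) as hc; split.
      * surface_identity hU.
      * to_reals; pose proof (Rinv_0_lt_compat (2 * cos u) ltac:(lra)).
        unfold Rdiv; nra.
    + exact C0_has_data.
    + reflexivity.
    + intros u v _; simpl; ring.
  - apply conformal_minimal_of_data with (conjugate_data C0_data).
    + exact H1_smooth.
    + exact H1_direct_normal.
    + intros u v hU; pose proof (cos_strip_pos u v hU) as hc; split.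
      * surface_identity hU.
      * to_reals; now apply Rinv_0_lt_compat.
    + exact H1_has_data.
    + reflexivity.
    + intros u v _; simpl; ring.
  - exists C0_data; split; [exact C0_has_data | exact H1_has_data].
Qed.

(** * Uniqueness of the normal and of the data of [C0] *)

(** [Nbar], the two partials and [C0_normal] form an orthogonal basis with squares $-1$,
    $1/\cos^2u$, $1/\cos^2u$, $1$; each coefficient is a product divided by a square. *)
Lemma C0_frame_expansion u v w : C0_domain u v ->
  w = plus (plus (scal (- inner w (Nbar (C0 u v))) (Nbar (C0 u v)))
                 (scal (cos u ^ 2 * inner w (partial Du C0 u v))
                    (partial Du C0 u v)))
           (plus (scal (cos u ^ 2 * inner w (partial Dv C0 u v))
                    (partial Dv C0 u v))
                 (scal (inner w (C0_normal u v)) (C0_normal u v))).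
Proof.
  intros hU; destruct w as [[[w0 w1] w2] w3].
  apply vector_eq; surface_identity hU.
Qed.

(** In the frame expansion only the multiple [k] of [C0_normal] survives. Unit length gives $k^2=1$
    and directness gives $k>0$. *)
Lemma C0_normal_unique N u v : direct_unit_normal C0_domain C0 N ->
  C0_domain u v -> N u v = C0_normal u v.
Proof.
  intros [_ hN] hU; destruct (hN u v hU) as (h1 & h2 & h3 & h4).
  assert (hu : inner (N u v) (partial Du C0 u v) = 0).
  { rewrite <- (h2 (1, 0)); to_reals; ring. }
  assert (hv : inner (N u v) (partial Dv C0 u v) = 0).
  { rewrite <- (h2 (0, 1)); to_reals; ring. }
  pose proof (C0_frame_expansion u v (N u v) hU) as e.
  rewrite h1, hu, hv in e.
  set (k := inner (N u v) (C0_normal u v)) in e; clearbody k.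
  assert (ek : N u v = scal k (C0_normal u v)).
  { rewrite e; apply vector_eq; to_reals; ring. }
  clear e; rewrite ek in h3, h4 |- *; clear - h3 h4 hU.
  assert (hs : k * k = 1) by (rewrite <- h3; surface_identity hU).
  assert (hd : 0 < k * / cos u ^ 2).
  { replace (k * / cos u ^ 2) with (det4 (Nbar (C0 u v)) (partial Du C0 u v)
      (partial Dv C0 u v) (scal k (C0_normal u v))) by surface_identity hU.
    exact h4. }
  assert (hk : 0 < k).
  { pose proof (cos_strip_pos u v hU).
    assert (0 < / cos u ^ 2) by (apply Rinv_0_lt_compat; nra). nra. }
  assert (k = 1) as -> by nra.
  apply vector_eq; to_reals; ring.
Qed.

Lemma C0_normal_partials_unique N u v : direct_unit_normal C0_domain C0 N ->
  C0_domain u v ->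
  partial Du N u v = partial Du C0_normal u v /\
  partial Dv N u v = partial Dv C0_normal u v.
Proof.
  intros hN hU; unfold partial.
  split; apply vector_eq; cbn [fst snd c0 c1 c2];
    (apply Du_ext_strip || apply Dv_ext_strip); try exact hU;
    intros s t hst; now rewrite (C0_normal_unique N s t hN hst).
Qed.

(** Products of $dx(X)$ with the two partials recover the components of $X$ up to the factor
    $1/\cos^2u$. *)
Lemma C0_diff_inj u v X Y : C0_domain u v ->
  diff C0 u v X = diff C0 u v Y -> X = Y.
Proof.
  intros hU e.
  assert (hu : forall Z, cos u ^ 2 * inner (diff C0 u v Z) (partial Du C0 u v)
                         = fst Z) by (intros [Z1 Z2]; surface_identity hU).
  assert (hv : forall Z, cos u ^ 2 * inner (diff C0 u v Z) (partial Dv C0 u v)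
                         = snd Z) by (intros [Z1 Z2]; surface_identity hU).
  rewrite (surjective_pairing X), (surjective_pairing Y).
  now rewrite <- !hu, <- !hv, e.
Qed.

(** The normal is forced, hence so are its derivatives and the angle. Injectivity of $dx$ then
    determines the shape operator, and testing the projection on coordinate vectors determines $T$.
    The equalities are pointwise because [D] is constrained on the strip only. *)
Lemma C0_data_unique N D u v : direct_unit_normal C0_domain C0 N ->
  has_data C0_domain C0 N D -> C0_domain u v ->
  (forall X Y, metric D u v X Y = metric C0_data u v X Y) /\
  (forall X, shape D u v X = shape C0_data u v X) /\
  vert D u v = vert C0_data u v /\ angle D u v = angle C0_data u v.
Proof.
  intros hN hD hU.
  destruct (hD u v hU) as (h1 & h2 & _ & h4 & h5).
  destruct (C0_has_data u v hU) as (g1 & g2 & _ & _ & g5).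
  destruct (C0_normal_partials_unique N u v hN hU) as [eu ev].
  split; [|split; [|split]].
  - intros X Y; now rewrite h1, g1.
  - intros X; apply (C0_diff_inj u v _ _ hU).
    rewrite h2, g2; unfold nabla_bar, diff; now rewrite eu, ev.
  (* The height of [C0] is $u$, so $\langle\partial_t,dx(X)\rangle$ is the first component of
     $X$. *)
  - assert (h : forall X, inner (minus dt (diff C0 u v (vert D u v)))
                  (diff C0 u v X) =
                fst X - / cos u ^ 2 * (fst (vert D u v) * fst X
                                       + snd (vert D u v) * snd X)).
    { intros [X1 X2]; destruct (vert D u v) as [T1 T2]; surface_identity hU. }
    pose proof (h4 (1, 0)) as k1; pose proof (h4 (0, 1)) as k2.
    rewrite h in k1, k2; simpl fst in *; simpl snd in *.
    destruct (vert D u v) as [T1 T2]; simpl in *.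
    pose proof (cos_strip_pos u v hU).
    f_equal.
    + replace T1 with (cos u ^ 2 * (/ cos u ^ 2 * (T1 * 1 + T2 * 0)))
        by (field; lra).
      replace (/ cos u ^ 2 * (T1 * 1 + T2 * 0)) with 1 by (simpl; lra). ring.
    + replace T2 with (cos u ^ 2 * (/ cos u ^ 2 * (T1 * 0 + T2 * 1)))
        by (field; lra).
      replace (/ cos u ^ 2 * (T1 * 0 + T2 * 1)) with 0 by (simpl; lra). ring.
  - rewrite h5, g5; now rewrite (C0_normal_unique N u v hN hU).
Qed.

(** [conjugate_immersion] only provides some normal and some data for [C0]; their uniqueness makes
    the data of [y] explicit. *)
Lemma C0_conjugate_data N y M : conjugate_immersion C0_domain C0 N y M ->
  has_data C0_domain y M (conjugate_data C0_data).
Proof.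
  intros ((_ & hN & _) & _ & D & hD & hy) u v hU.
  destruct (C0_data_unique N D u v hN hD hU) as (e1 & e2 & e3 & e4).
  destruct (hy u v hU) as (h1 & h2 & h3 & h4 & h5).
  cbn [metric shape vert angle conjugate_data] in *.
  split; [|split; [|split; [|split]]].
  - intros X Y; now rewrite <- h1, e1.
  - intros X; now rewrite <- h2, e2.
  - intros X Y; now rewrite <- !e1, <- !e2, h3.
  - intros X; now rewrite <- e3, h4.
  - now rewrite <- e4.
Qed.

(** * Frames of Lorentz space *)

Lemma L3_eq (a b : L3) : c0 a = c0 b -> c1 a = c1 b -> c2 a = c2 b -> a = b.
Proof.
  destruct a as [[a0 a1] a2], b as [[b0 b1] b2].
  unfold c0, c1, c2; simpl; congruence.
Qed.

Lemma lorentz_comm a b : lorentz a b = lorentz b a.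
Proof. unfold lorentz; ring. Qed.

(** Three terms match the frames used below; shorter combinations are padded with coefficient 0 or
    with [zero]. *)
Definition lin_comb (r : R) (a : L3) (s : R) (b : L3) (t : R) (c : L3) : L3 :=
  plus (scal r a) (plus (scal s b) (scal t c)).

Lemma lorentz_lin_comb w r a s b t c :
  lorentz w (lin_comb r a s b t c) =
  r * lorentz w a + s * lorentz w b + t * lorentz w c.
Proof.
  destruct a as [[? ?] ?], b as [[? ?] ?], c as [[? ?] ?]; to_reals; ring.
Qed.

Definition lorentz_frame (a b c : L3) : Prop :=
  lorentz a a = -1 /\ lorentz b b = 1 /\ lorentz c c = 1 /\
  lorentz a b = 0 /\ lorentz a c = 0 /\ lorentz b c = 0.

(** Gram determinant; the overall minus sign is the determinant of the Lorentz form. *)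
Lemma det3_gram a b c :
  det3 a b c ^ 2 =
  - (lorentz a a * (lorentz b b * lorentz c c - lorentz b c ^ 2)
     - lorentz a b * (lorentz a b * lorentz c c - lorentz b c * lorentz a c)
     + lorentz a c * (lorentz a b * lorentz b c - lorentz b b * lorentz a c)).
Proof. unfold det3, lorentz; ring. Qed.

(** Cramer's rule: cofactor combinations of the three products give the determinant times each
    coordinate of [w]. The time coordinate carries the sign of the form. *)
Lemma lorentz_nondegenerate a b c w : det3 a b c <> 0 ->
  lorentz a w = 0 -> lorentz b w = 0 -> lorentz c w = 0 -> w = zero.
Proof.
  intros hd ha hb hc.
  apply L3_eq; apply (Rmult_eq_reg_l (det3 a b c)); trivial.
  - transitivity (- ((c1 b * c2 c - c2 b * c1 c) * lorentz a w
      - (c1 a * c2 c - c2 a * c1 c) * lorentz b w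
      + (c1 a * c2 b - c2 a * c1 b) * lorentz c w)).
    + unfold det3, lorentz; ring.
    + rewrite ha, hb, hc; to_reals; ring.
  - transitivity (- (c0 b * c2 c - c2 b * c0 c) * lorentz a w
      + (c0 a * c2 c - c2 a * c0 c) * lorentz b w
      - (c0 a * c2 b - c2 a * c0 b) * lorentz c w).
    + unfold det3, lorentz; ring.
    + rewrite ha, hb, hc; to_reals; ring.
  - transitivity ((c0 b * c1 c - c1 b * c0 c) * lorentz a w
      - (c0 a * c1 c - c1 a * c0 c) * lorentz b w
      + (c0 a * c1 b - c1 a * c0 b) * lorentz c w).
    + unfold det3, lorentz; ring.
    + rewrite ha, hb, hc; to_reals; ring.
Qed.

(** By [det3_gram] the squared determinant is [be * ga], hence nonzero, and the difference of the
    two sides is orthogonal to all three vectors. *)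
Lemma lorentz_orthogonal_expansion a b c be ga w :
  lorentz a a = -1 -> lorentz b b = be -> lorentz c c = ga ->
  lorentz a b = 0 -> lorentz a c = 0 -> lorentz b c = 0 ->
  be <> 0 -> ga <> 0 ->
  w = lin_comb (- lorentz a w) a (lorentz b w / be) b (lorentz c w / ga) c.
Proof.
  intros haa hbb hcc hab hac hbc hbe hga.
  assert (hd : det3 a b c <> 0).
  { intros h; pose proof (det3_gram a b c) as e.
    rewrite h, haa, hbb, hcc, hab, hac, hbc in e.
    apply (Rmult_integral_contrapositive_currified be ga hbe hga); lra. }
  set (w' := lin_comb _ _ _ _ _ _).
  (* The combination [lin_comb 1 w (-1) w' 0 w] is $w-w'$. *)
  assert (hw : forall z, lorentz z (lin_comb 1 w (-1) w' 0 w)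
                         = lorentz z w - lorentz z w')
    by (intros z; rewrite lorentz_lin_comb; ring).
  assert (e : lin_comb 1 w (-1) w' 0 w = zero).
  { apply (lorentz_nondegenerate a b c); trivial; rewrite hw; unfold w';
      rewrite lorentz_lin_comb, ?(lorentz_comm b a), ?(lorentz_comm c a),
        ?(lorentz_comm c b), ?haa, ?hbb, ?hcc, ?hab, ?hac, ?hbc;
      field; split; assumption. }
  clear hw; clearbody w'.
  pose proof (f_equal c0 e) as e0; pose proof (f_equal c1 e) as e1;
  pose proof (f_equal c2 e) as e2.
  destruct w as [[w0 w1] w2], w' as [[x0 x1] x2].
  revert e0 e1 e2; to_reals; intros.
  apply L3_eq; to_reals; lra.
Qed.

Lemma lorentz_frame_expansion a b c w : lorentz_frame a b c ->
  w = lin_comb (- lorentz a w) a (lorentz b w) b (lorentz c w) c.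
Proof.
  intros (haa & hbb & hcc & hab & hac & hbc).
  rewrite <- (Rdiv_1_r (lorentz b w)), <- (Rdiv_1_r (lorentz c w)).
  apply lorentz_orthogonal_expansion; lra.
Qed.

(** Coefficients in a Lorentz frame; the sign comes from $\langle a,a\rangle=-1$. The frame itself
    goes to the canonical basis. *)
Definition frame_coordinates (a b c w : L3) : L3 :=
  (- lorentz a w, lorentz b w, lorentz c w).

Lemma frame_coordinates_isometry a b c :
  lorentz_frame a b c -> 0 < c0 a -> 0 < det3 a b c ->
  direct_isometry_H2 (frame_coordinates a b c).
Proof.
  intros hF ha hd.
  assert (hiso : forall w w', lorentz (frame_coordinates a b c w)
            (frame_coordinates a b c w') = lorentz w w').
  { intros w w'.
    (* Expanding only [w'] already yields the Lorentz product of the two coordinate vectors. *)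
    rewrite (lorentz_frame_expansion a b c w' hF) at 2.
    rewrite lorentz_lin_comb.
    rewrite (lorentz_comm w a), (lorentz_comm w b), (lorentz_comm w c).
    unfold frame_coordinates.
    set (x := lorentz a w); set (x' := lorentz a w').
    unfold lorentz at 1, c0, c1, c2; cbn [fst snd]; ring. }
  split; [|split; [|split; [|split]]].
  - intros [[? ?] ?] [[? ?] ?]; apply L3_eq; to_reals; ring.
  - intros r [[? ?] ?]; apply L3_eq; to_reals; ring.
  - exact hiso.
  - intros p [hp hp0]; split; [now rewrite hiso|].
    destruct hF as [haa _]; unfold frame_coordinates, c0; cbn [fst snd].
    (* Cauchy-Schwarz for the space-like parts of [a] and [p]. *)
    revert ha hp hp0 haa; unfold lorentz.
    destruct a as [[a0 a1] a2], p as [[p0 p1] p2].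
    unfold c0, c1, c2; cbn [fst snd]; intros.
    assert (hcs : (a1 * p1 + a2 * p2) ^ 2 < (a0 * p0) ^ 2).
    { assert ((a1 * p1 + a2 * p2) ^ 2 <= (a1 ^ 2 + a2 ^ 2) * (p1 ^ 2 + p2 ^ 2))
        by (pose proof (pow2_ge_0 (a1 * p2 - a2 * p1)); nra).
      replace (a1 ^ 2 + a2 ^ 2) with (a0 ^ 2 - 1) in * by nra.
      replace (p1 ^ 2 + p2 ^ 2) with (p0 ^ 2 - 1) in * by nra.
      nra. }
    assert (0 < a0 * p0) by nra.
    nra.
  (* The matrix is the transposed frame with its first row and first column negated; the two signs
     cancel. *)
  - replace (det3 _ _ _) with (det3 a b c); [exact hd|].
    unfold frame_coordinates, det3, lorentz, c0, c1, c2; cbn [fst snd]; ring.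
Qed.

(** * Differentiation of Lorentz products *)

Definition is_derive3 (a : R -> L3) (t : R) (X : L3) : Prop :=
  is_derive (fun s => c0 (a s)) t (c0 X) /\
  is_derive (fun s => c1 (a s)) t (c1 X) /\
  is_derive (fun s => c2 (a s)) t (c2 X).

Lemma is_derive_lorentz a b t X Y :
  is_derive3 a t X -> is_derive3 b t Y ->
  is_derive (fun s => lorentz (a s) (b s)) t
    (lorentz X (b t) + lorentz (a t) Y).
Proof.
  intros (ha0 & ha1 & ha2) (hb0 & hb1 & hb2).
  pose proof (is_derive_mult _ _ t _ _ ha0 hb0 Rmult_comm) as h0.
  pose proof (is_derive_mult _ _ t _ _ ha1 hb1 Rmult_comm) as h1.
  pose proof (is_derive_mult _ _ t _ _ ha2 hb2 Rmult_comm) as h2.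
  pose proof (is_derive_plus _ _ t _ _
    (is_derive_plus _ _ t _ _ (is_derive_opp _ t _ h0) h1) h2) as h.
  apply is_derive_eq with (1 := h).
  unfold plus, opp, mult; simpl; unfold mult, lorentz; simpl; ring.
Qed.

(** Differentiating relations valid near a point turns the algebraic relations of the moving frame
    into its structure equations. *)
Lemma lorentz_derive_eq a b f t X Y l :
  is_derive3 a t X -> is_derive3 b t Y ->
  locally t (fun s => f s = lorentz (a s) (b s)) -> is_derive f t l ->
  lorentz X (b t) + lorentz (a t) Y = l.
Proof.
  intros ha hb hl hf.
  rewrite <- (is_derive_unique _ _ _ (is_derive_lorentz a b t X Y ha hb)).
  rewrite <- (is_derive_unique _ _ _ hf).
  symmetry; now apply Derive_ext_loc.
Qed.

(** * Rigidity *)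

Lemma smooth_Du U f : smooth U f -> smooth U (Du f).
Proof. intros h k; apply (h (S k)). Qed.

Lemma smooth_map_Du U x : smooth_map U x -> smooth_map U (partial Du x).
Proof.
  intros (h0 & h1 & h2 & h3).
  repeat split; apply smooth_Du; assumption.
Qed.

Lemma smooth_ex_derive U f u v : smooth U f -> U u v ->
  ex_derive (fun s => f s v) u /\ ex_derive (fun t => f u t) v.
Proof. intros h hU; destruct (h 1%nat) as [h1 _]; exact (h1 u v hU). Qed.

Lemma smooth_map_derive_u U x u v : smooth_map U x -> U u v ->
  is_derive3 (fun s => fst (x s v)) u (fst (partial Du x u v)).
Proof.
  intros (h0 & h1 & h2 & _) hU.
  split; [|split]; apply Derive_correct.
  - exact (proj1 (smooth_ex_derive U _ u v h0 hU)).
  - exact (proj1 (smooth_ex_derive U _ u v h1 hU)).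
  - exact (proj1 (smooth_ex_derive U _ u v h2 hU)).
Qed.

Lemma smooth_map_derive_v U x u v : smooth_map U x -> U u v ->
  is_derive3 (fun t => fst (x u t)) v (fst (partial Dv x u v)).
Proof.
  intros (h0 & h1 & h2 & _) hU.
  split; [|split]; apply Derive_correct.
  - exact (proj2 (smooth_ex_derive U _ u v h0 hU)).
  - exact (proj2 (smooth_ex_derive U _ u v h1 hU)).
  - exact (proj2 (smooth_ex_derive U _ u v h2 hU)).
Qed.

(* Here [p, m, yu, yv, mu, mv] stand for the values at a point of [y], [M] and
   of their partial derivatives, where [(y, M)] is an immersion whose data are
   those of the conjugate of [C0]. *)
Record conjugate_relations (u : R) (p m yu yv mu mv : L3R) : Prop := {
  rel_p : hyperboloid (fst p);
  rel_uu : lorentz (fst yu) (fst yu) = / cos u ^ 2;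
  rel_uv : lorentz (fst yu) (fst yv) = 0;
  rel_tu : snd yu = 0;
  rel_tv : snd yv = 1;
  rel_angle : snd m = sin u;
  rel_mm : lorentz (fst m) (fst m) = cos u ^ 2;
  rel_mp : lorentz (fst m) (fst p) = 0;
  rel_mu : lorentz (fst m) (fst yu) = 0;
  rel_mv : lorentz (fst m) (fst yv) = - sin u;
  rel_direct : 0 < det4 (Nbar p) yu yv m;
  rel_Mu : exists k, fst mu =
    lin_comb (cos u) (fst yv) k (fst p) 0 zero;
  rel_Mv : exists k, fst mv =
    lin_comb (cos u) (fst yu) k (fst p) 0 zero
}.

(** The data are evaluated on the coordinate vectors. The conjugate of $T$ is $\cos^2u\,\partial_v$,
    so the height has partials 0 and 1; removing the vertical parts leaves the Lorentz products. *)
Lemma conjugate_relations_of_data y M u v :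
  conformal_minimal_immersion C0_domain y M ->
  has_data C0_domain y M (conjugate_data C0_data) ->
  C0_domain u v ->
  conjugate_relations u (y u v) (M u v) (partial Du y u v) (partial Dv y u v)
    (partial Du M u v) (partial Dv M u v).
Proof.
  intros (_ & (_ & hN) & hH & _) hD hU.
  pose proof (cos_strip_pos u v hU) as hc.
  destruct (hN u v hU) as (n1 & n2 & n3 & n4).
  destruct (hD u v hU) as (d1 & d2 & _ & d4 & d5).
  specialize (hH u v hU); unfold H2xR in hH.
  pose proof (n2 (1, 0)) as n21; pose proof (n2 (0, 1)) as n22.
  pose proof (d1 (1, 0) (1, 0)) as d11; pose proof (d1 (1, 0) (0, 1)) as d12.
  pose proof (d1 (0, 1) (0, 1)) as d13.
  pose proof (d2 (1, 0)) as d21; pose proof (d2 (0, 1)) as d22.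
  pose proof (d4 (1, 0)) as d41; pose proof (d4 (0, 1)) as d42.
  clear hN hD n2 d1 d2 d4.
  unfold nabla_bar, diff in *.
  cbn [metric shape vert angle conjugate_data C0_data J fst snd] in *.
  set (yu := partial Du y u v) in *; set (yv := partial Dv y u v) in *.
  set (Mu := partial Du M u v) in *; set (Mv := partial Dv M u v) in *.
  set (p := y u v) in *; set (m := M u v) in *.
  clearbody yu yv Mu Mv p m.
  assert (e1 : inner yu yu = / cos u ^ 2).
  { clear - d11; destruct yu as [[[? ?] ?] ?], yv as [[[? ?] ?] ?].
    revert d11; to_reals; intros; lra. }
  assert (e2 : inner yu yv = 0).
  { clear - d12; destruct yu as [[[? ?] ?] ?], yv as [[[? ?] ?] ?].
    revert d12; to_reals; intros; lra. }
  assert (e3 : inner yv yv = / cos u ^ 2).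
  { clear - d13; destruct yu as [[[? ?] ?] ?], yv as [[[? ?] ?] ?].
    revert d13; to_reals; intros; lra. }
  assert (e4 : snd yu = 0).
  { transitivity (snd yu - cos u ^ 2 * inner yu yv); [rewrite e2; ring|].
    clear - d41; destruct yu as [[[? ?] ?] ?], yv as [[[? ?] ?] ?].
    rewrite <- d41; to_reals; ring. }
  assert (e5 : snd yv = 1).
  { assert (snd yv - cos u ^ 2 * inner yv yv = 0);
      [|rewrite e3 in *; field_simplify in H; lra].
    clear - d42; destruct yu as [[[? ?] ?] ?], yv as [[[? ?] ?] ?].
    rewrite <- d42; to_reals; ring. }
  assert (e6 : snd m = sin u).
  { rewrite d5; clear; destruct m as [[[? ?] ?] ?]; to_reals; ring. }
  assert (e7 : inner m yu = 0).
  { rewrite <- n21; clear.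
    destruct m as [[[? ?] ?] ?], yu as [[[? ?] ?] ?], yv as [[[? ?] ?] ?].
    to_reals; ring. }
  assert (e8 : inner m yv = 0).
  { rewrite <- n22; clear.
    destruct m as [[[? ?] ?] ?], yu as [[[? ?] ?] ?], yv as [[[? ?] ?] ?].
    to_reals; ring. }
  pose proof (sin2_cos2 u) as hsc; unfold Rsqr in hsc.
  split; trivial.
  - rewrite <- e1; unfold inner; rewrite e4; ring.
  - rewrite <- e2; unfold inner; rewrite e4; ring.
  - unfold inner in n3; rewrite e6 in n3; nra.
  - rewrite <- n1; unfold inner, Nbar; simpl; ring.
  - rewrite <- e7; unfold inner; rewrite e4; ring.
  - unfold inner in e8; rewrite e5, e6 in e8; lra.
  (* The multiple of [p] comes from the projection in [nabla_bar]; its value is found later by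
     differentiating $\langle m,p\rangle=0$. *)
  - set (k := inner _ _) in d21; exists (- k); clearbody k; clear - d21.
    destruct yu as [[[? ?] ?] ?], yv as [[[? ?] ?] ?], p as [[[? ?] ?] ?],
      Mu as [[[? ?] ?] ?], Mv as [[[? ?] ?] ?].
    pose proof (f_equal (fun w => c0 (fst w)) d21) as h0.
    pose proof (f_equal (fun w => c1 (fst w)) d21) as h1.
    pose proof (f_equal (fun w => c2 (fst w)) d21) as h2.
    clear - h0 h1 h2; revert h0 h1 h2; to_reals; intros; apply L3_eq; to_reals; lra.
  - set (k := inner _ _) in d22; exists (- k); clearbody k; clear - d22.
    destruct yu as [[[? ?] ?] ?], yv as [[[? ?] ?] ?], p as [[[? ?] ?] ?],
      Mu as [[[? ?] ?] ?], Mv as [[[? ?] ?] ?].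
    pose proof (f_equal (fun w => c0 (fst w)) d22) as h0.
    pose proof (f_equal (fun w => c1 (fst w)) d22) as h1.
    pose proof (f_equal (fun w => c2 (fst w)) d22) as h2.
    clear - h0 h1 h2; revert h0 h1 h2; to_reals; intros; apply L3_eq; to_reals; lra.
Qed.

Lemma locally_strip_u (P : R -> Prop) u v :
  (forall s, C0_domain s v -> P s) -> C0_domain u v -> locally u P.
Proof.
  intros h hU.
  generalize (locally_2d_1d_const_y _ _ _ (C0_domain_open u v hU)).
  apply filter_imp; exact h.
Qed.

Lemma locally_strip_v (P : R -> Prop) u v :
  (forall t, C0_domain u t -> P t) -> C0_domain u v -> locally v P.
Proof. intros h hU; apply filter_forall; intros t; apply h, hU. Qed.

(** $(p,p_u,m)$ is an orthogonal basis with squares $-1$, $1/\cos^2u$, $\cos^2u$. Differentiating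
    the relations between these vectors gives the products of $p_{uu}$ and $p_{uv}$ with the basis;
    the derivatives of $m$ come from the shape operator. Since $p_v$ is a multiple of $m$, the
    system closes. *)
Lemma conjugate_structure_equations y M u v :
  smooth_map C0_domain y -> smooth_map C0_domain M ->
  (forall s t, C0_domain s t ->
     conjugate_relations s (y s t) (M s t) (partial Du y s t)
       (partial Dv y s t) (partial Du M s t) (partial Dv M s t)) ->
  C0_domain u v ->
  let p := fst (y u v) in let m := fst (M u v) in
  let pu := fst (partial Du y u v) in
  lorentz p pu = 0 /\
  fst (partial Dv y u v) = lin_comb 0 p 0 pu (- sin u / cos u ^ 2) m /\
  fst (partial Du (partial Du y) u v) =
    lin_comb (/ cos u ^ 2) p (sin u / cos u) pu 0 m /\
  fst (partial Dv (partial Du y) u v) = lin_comb 0 p 0 pu (- / cos u ^ 3) m /\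
  fst (partial Du M u v) = lin_comb 0 p 0 pu (- sin u / cos u) m /\
  fst (partial Dv M u v) = lin_comb (- sin u) p (cos u) pu 0 m.
Proof.
  intros hy hM hrel hU; cbv zeta.
  pose proof (cos_strip_pos u v hU) as hc.
  pose proof (smooth_map_derive_u _ y u v hy hU) as dyu.
  pose proof (smooth_map_derive_v _ y u v hy hU) as dyv.
  pose proof (smooth_map_derive_u _ M u v hM hU) as dMu.
  pose proof (smooth_map_derive_v _ M u v hM hU) as dMv.
  pose proof (smooth_map_derive_u _ _ u v (smooth_map_Du _ y hy) hU) as duu.
  pose proof (smooth_map_derive_v _ _ u v (smooth_map_Du _ y hy) hU) as duv.
  assert (rp : forall s t, C0_domain s t ->
            -1 = lorentz (fst (y s t)) (fst (y s t))).
  { intros s t h; symmetry; apply (rel_p _ _ _ _ _ _ _ (hrel s t h)). }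
  assert (rmp : forall s t, C0_domain s t ->
            0 = lorentz (fst (M s t)) (fst (y s t))).
  { intros s t h; symmetry; apply (rel_mp _ _ _ _ _ _ _ (hrel s t h)). }
  assert (ruu : forall s t, C0_domain s t -> / cos s ^ 2 =
            lorentz (fst (partial Du y s t)) (fst (partial Du y s t))).
  { intros s t h; symmetry; apply (rel_uu _ _ _ _ _ _ _ (hrel s t h)). }
  assert (rmu : forall s t, C0_domain s t -> 0 =
            lorentz (fst (M s t)) (fst (partial Du y s t))).
  { intros s t h; symmetry; apply (rel_mu _ _ _ _ _ _ _ (hrel s t h)). }
  assert (dcst : forall (k t : R), is_derive (fun _ => k) t 0)
    by (intros k t; apply (is_derive_const k t)).
  assert (dcos : is_derive (fun s => / cos s ^ 2) u (2 * sin u / cos u ^ 3))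
    by (auto_derive; [nra | field; lra]).
  (* In pairs, the $u$- and $v$-derivatives of $\langle p,p\rangle=-1$, $\langle m,p\rangle=0$,
     $\langle p_u,p_u\rangle=1/\cos^2u$ and $\langle m,p_u\rangle=0$. *)
  pose proof (lorentz_derive_eq _ _ (fun _ => -1) _ _ _ _ dyu dyu
    (locally_strip_u _ u v (fun s => rp s v) hU) (dcst _ _)) as k1.
  pose proof (lorentz_derive_eq _ _ (fun _ => -1) _ _ _ _ dyv dyv
    (locally_strip_v _ u v (fun t => rp u t) hU) (dcst _ _)) as k2.
  pose proof (lorentz_derive_eq _ _ (fun _ => 0) _ _ _ _ dMu dyu
    (locally_strip_u _ u v (fun s => rmp s v) hU) (dcst _ _)) as k3.
  pose proof (lorentz_derive_eq _ _ (fun _ => 0) _ _ _ _ dMv dyv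
    (locally_strip_v _ u v (fun t => rmp u t) hU) (dcst _ _)) as k4.
  pose proof (lorentz_derive_eq _ _ _ _ _ _ _ duu duu
    (locally_strip_u _ u v (fun s => ruu s v) hU) dcos) as k5.
  pose proof (lorentz_derive_eq _ _ (fun _ => / cos u ^ 2) _ _ _ _ duv duv
    (locally_strip_v _ u v (fun t => ruu u t) hU) (dcst _ _)) as k6.
  pose proof (lorentz_derive_eq _ _ (fun _ => 0) _ _ _ _ dMu duu
    (locally_strip_u _ u v (fun s => rmu s v) hU) (dcst _ _)) as k7.
  pose proof (lorentz_derive_eq _ _ (fun _ => 0) _ _ _ _ dMv duv
    (locally_strip_v _ u v (fun t => rmu u t) hU) (dcst _ _)) as k8.
  (* Orthogonality of $p_u$ and $p$ is derived on the whole strip because it is differentiated in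
     turn. *)
  assert (rpu : forall s t, C0_domain s t -> 0 =
            lorentz (fst (partial Du y s t)) (fst (y s t))).
  { intros s t h.
    pose proof (smooth_map_derive_u _ y s t hy h) as d.
    pose proof (lorentz_derive_eq _ _ (fun _ => -1) _ _ _ _ d d
      (locally_strip_u _ s t (fun s' => rp s' t) h) (dcst _ _)) as k.
    cbv beta in k; rewrite (lorentz_comm (fst (y s t))) in k; lra. }
  pose proof (lorentz_derive_eq _ _ (fun _ => 0) _ _ _ _ duu dyu
    (locally_strip_u _ u v (fun s => rpu s v) hU) (dcst _ _)) as k9.
  pose proof (lorentz_derive_eq _ _ (fun _ => 0) _ _ _ _ duv dyv
    (locally_strip_v _ u v (fun t => rpu u t) hU) (dcst _ _)) as k10.
  destruct (hrel u v hU) as [[hpp _] huu huv _ _ _ hmm hmp hmu hmv _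
    [ku hMu] [kv hMv]].
  cbv beta in *.
  clear dyu dyv dMu dMv duu duv rp rmp ruu rmu rpu dcst dcos hrel hy hM.
  set (p := fst (y u v)) in *; set (m := fst (M u v)) in *.
  set (pu := fst (partial Du y u v)) in *.
  set (pv := fst (partial Dv y u v)) in *.
  set (puu := fst (partial Du (partial Du y) u v)) in *.
  set (puv := fst (partial Dv (partial Du y) u v)) in *.
  set (mu := fst (partial Du M u v)) in *.
  set (mv := fst (partial Dv M u v)) in *.
  clearbody p m pu pv puu puv mu mv.
  rewrite (lorentz_comm p pu) in k1; rewrite (lorentz_comm p pv) in k2.
  assert (hpu : lorentz p pu = 0) by (rewrite lorentz_comm; lra).
  assert (hpv : lorentz p pv = 0) by (rewrite lorentz_comm; lra).
  rewrite (lorentz_comm pu puu) in k5; rewrite (lorentz_comm pu puv) in k6.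
  assert (hexp : forall w, w = lin_comb (- lorentz p w) p
            (lorentz pu w / / cos u ^ 2) pu (lorentz m w / cos u ^ 2) m).
  { intros w; apply lorentz_orthogonal_expansion; trivial;
      try (rewrite lorentz_comm; assumption).
    - assert (0 < / cos u ^ 2) by (apply Rinv_0_lt_compat; nra); lra.
    - nra. }
  assert (hpz : lorentz p zero = 0) by (unfold lorentz; to_reals; ring).
  assert (huz : lorentz pu zero = 0) by (unfold lorentz; to_reals; ring).
  (* By [k3] and [k4] the open coefficients are $\langle m,p_u\rangle=0$ and $\langle
     m,p_v\rangle=-\sin u$. *)
  assert (hku : ku = 0).
  { rewrite (lorentz_comm mu), hMu, lorentz_lin_comb, hpv, hpp, hmu, hpz in k3.
    lra. }
  assert (hkv : kv = - sin u).
  { rewrite (lorentz_comm mv), hMv, lorentz_lin_comb, hpu, hpp, hmv, hpz in k4.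
    lra. }
  assert (epv : pv = lin_comb 0 p 0 pu (- sin u / cos u ^ 2) m).
  { rewrite (hexp pv), hpv, huv, hmv; f_equal; field; lra. }
  rewrite (lorentz_comm mu), hMu, lorentz_lin_comb, (lorentz_comm pu p), hpu,
    huv, huz in k7.
  rewrite (lorentz_comm mv), hMv, lorentz_lin_comb, (lorentz_comm pu p), hpu,
    huu, huz in k8.
  rewrite huu in k9; rewrite huv in k10.
  split; [exact hpu|]; split; [exact epv|].
  split; [|split; [|split]].
  - rewrite (hexp puu), (lorentz_comm p puu), (lorentz_comm pu puu).
    replace (lorentz puu p) with (- / cos u ^ 2) by lra.
    replace (lorentz puu pu) with (sin u / cos u ^ 3) by lra.
    replace (lorentz m puu) with 0 by lra.
    f_equal; field; lra.
  - rewrite (hexp puv), (lorentz_comm p puv), (lorentz_comm pu puv).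
    replace (lorentz puv p) with 0 by lra.
    replace (lorentz puv pu) with 0 by lra.
    replace (lorentz m puv) with (- (cos u * / cos u ^ 2)) by lra.
    f_equal; field; lra.
  - rewrite hMu, hku, epv.
    apply L3_eq; destruct p as [[? ?] ?], pu as [[? ?] ?], m as [[? ?] ?];
      to_reals; field; lra.
  - rewrite hMv, hkv.
    apply L3_eq; destruct p as [[? ?] ?], pu as [[? ?] ?], m as [[? ?] ?];
      to_reals; field; lra.
Qed.

(** * Integration of the structure equations *)

(** A path running horizontally to the axis $u=0$ and then along it to the origin stays in the
    strip. *)
Lemma constant_on_strip f :
  (forall u v, C0_domain u v ->
     is_derive (fun s => f s v) u 0 /\ is_derive (fun t => f u t) v 0) ->
  forall u v, C0_domain u v -> f u v = f 0 0.
Proof.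
  intros hf u v hU; assert (hpi := PI_RGT_0).
  assert (hline : forall g : R -> R, forall s t,
    (forall r, Rmin s t <= r <= Rmax s t -> is_derive g r 0) -> g s = g t).
  { intros g s t hg; destruct (Rtotal_order s t) as [h | [-> | h]]; trivial.
    - apply (eq_is_derive g); trivial; intros r hr; apply hg.
      rewrite Rmin_left, Rmax_right; lra.
    - symmetry; apply (eq_is_derive g); trivial; intros r hr; apply hg.
      rewrite Rmin_right, Rmax_left; lra. }
  destruct hU as [h1 h2].
  rewrite (hline (fun s => f s v) u 0).
  - apply (hline (fun t => f 0 t)); intros r _; refine (proj2 (hf 0 r _)); split; lra.
  - intros r hr; refine (proj1 (hf r v _)); split;
      revert hr; unfold Rmin, Rmax; destruct (Rle_dec u 0); lra.
Qed.

(* Componentwise solution of the structure equations: the three functions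
   shown to be constant are those of the vectors of a fixed frame of [L^3],
   read off from the explicit helicoid. *)
Lemma structure_equations_solution (P F Q : R -> R -> R) :
  (forall u v, C0_domain u v ->
     is_derive (fun s => P s v) u (F u v) /\
     is_derive (fun t => P u t) v (- sin u / cos u ^ 2 * Q u v) /\
     is_derive (fun s => F s v) u
       (/ cos u ^ 2 * P u v + sin u / cos u * F u v) /\
     is_derive (fun t => F u t) v (- / cos u ^ 3 * Q u v) /\
     is_derive (fun s => Q s v) u (- sin u / cos u * Q u v) /\
     is_derive (fun t => Q u t) v (- sin u * P u v + cos u * F u v)) ->
  forall u v, C0_domain u v ->
    P u v = / cos u * P 0 0 + sin u / cos u * cos v * F 0 0
            + - (sin u / cos u * sin v) * Q 0 0 /\
    Q u v = 0 * P 0 0 + cos u * sin v * F 0 0 + cos u * cos v * Q 0 0.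
Proof.
  intros h.
  (* In the expected solution $F-\tan u\,P$ is free of $P(0,0)$, and the pair [(Rr, Q / cos u)] is
     $(F(0,0),Q(0,0))$ rotated by $v$. [E1] and [E2] undo the rotation, [E2] giving $-Q(0,0)$. *)
  set (Rr := fun u v => F u v - sin u / cos u * P u v).
  set (E0 := fun u v => P u v / cos u - sin u * F u v).
  set (E1 := fun u v => cos v * Rr u v + sin v * (Q u v / cos u)).
  set (E2 := fun u v => sin v * Rr u v - cos v * (Q u v / cos u)).
  assert (h0 : forall u v, C0_domain u v -> E0 u v = E0 0 0 /\
    E1 u v = E1 0 0 /\ E2 u v = E2 0 0).
  { assert (hd : forall u v, C0_domain u v ->
      (is_derive (fun s => E0 s v) u 0 /\ is_derive (fun t => E0 u t) v 0) /\
      (is_derive (fun s => E1 s v) u 0 /\ is_derive (fun t => E1 u t) v 0) /\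
      (is_derive (fun s => E2 s v) u 0 /\ is_derive (fun t => E2 u t) v 0)).
    { intros u v hU; pose proof (cos_strip_pos u v hU) as hc.
      destruct (h u v hU) as (hPu & hPv & hFu & hFv & hQu & hQv).
      assert (ePu : Derive (fun s => P s v) u = F u v)
        by exact (is_derive_unique _ _ _ hPu).
      assert (ePv : Derive (fun t => P u t) v = - sin u / cos u ^ 2 * Q u v)
        by exact (is_derive_unique _ _ _ hPv).
      assert (eFu : Derive (fun s => F s v) u =
        / cos u ^ 2 * P u v + sin u / cos u * F u v)
        by exact (is_derive_unique _ _ _ hFu).
      assert (eFv : Derive (fun t => F u t) v = - / cos u ^ 3 * Q u v)
        by exact (is_derive_unique _ _ _ hFv).
      assert (eQu : Derive (fun s => Q s v) u = - sin u / cos u * Q u v)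
        by exact (is_derive_unique _ _ _ hQu).
      assert (eQv : Derive (fun t => Q u t) v = - sin u * P u v + cos u * F u v)
        by exact (is_derive_unique _ _ _ hQv).
      unfold E0, E1, E2, Rr.
      split; [split | split; split]; auto_derive;
        try (repeat split; trivial; try lra; eexists; eassumption);
        rewrite ?ePu, ?ePv, ?eFu, ?eFv, ?eQu, ?eQv;
        generalize (P u v) (F u v) (Q u v); clear - hc v; intros;
        trig_abstract u v. }
    intros u v hU; split; [|split]; apply constant_on_strip; trivial;
      intros s t hst; apply (hd s t hst). }
  intros u v hU; destruct (h0 u v hU) as (e0 & e1 & e2).
  pose proof (cos_strip_pos u v hU) as hc.
  assert (z0 : P 0 0 = E0 0 0) by (unfold E0; rewrite cos_0, sin_0; field).
  assert (z1 : F 0 0 = E1 0 0)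
    by (unfold E1, Rr; rewrite cos_0, sin_0; field).
  assert (z2 : Q 0 0 = - E2 0 0)
    by (unfold E2, Rr; rewrite cos_0, sin_0; field).
  rewrite z0, z1, z2, <- e0, <- e1, <- e2; unfold E0, E1, E2, Rr.
  generalize (P u v) (F u v) (Q u v); clear - hc v; intros.
  split; trig_abstract u v.
Qed.

Lemma c0_lin_comb r a s b t c :
  c0 (lin_comb r a s b t c) = r * c0 a + s * c0 b + t * c0 c.
Proof.
  destruct a as [[? ?] ?], b as [[? ?] ?], c as [[? ?] ?]; to_reals; ring.
Qed.

Lemma c1_lin_comb r a s b t c :
  c1 (lin_comb r a s b t c) = r * c1 a + s * c1 b + t * c1 c.
Proof.
  destruct a as [[? ?] ?], b as [[? ?] ?], c as [[? ?] ?]; to_reals; ring.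
Qed.

Lemma c2_lin_comb r a s b t c :
  c2 (lin_comb r a s b t c) = r * c2 a + s * c2 b + t * c2 c.
Proof.
  destruct a as [[? ?] ?], b as [[? ?] ?], c as [[? ?] ?]; to_reals; ring.
Qed.

Lemma lorentz_opp_l a b : lorentz (scal (-1) a) b = - lorentz a b.
Proof. destruct a as [[? ?] ?], b as [[? ?] ?]; to_reals; ring. Qed.

Lemma lorentz_opp_r a b : lorentz a (scal (-1) b) = - lorentz a b.
Proof. destruct a as [[? ?] ?], b as [[? ?] ?]; to_reals; ring. Qed.

Lemma C0_domain_origin : C0_domain 0 0.
Proof. assert (hpi := PI_RGT_0); split; lra. Qed.

(** Each coordinate of the structure equations is a scalar system solved by
    [structure_equations_solution]; the vectors are reassembled from their coordinates. *)
Lemma conjugate_immersion_explicit y M u v :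
  smooth_map C0_domain y -> smooth_map C0_domain M ->
  (forall s t, C0_domain s t ->
     conjugate_relations s (y s t) (M s t) (partial Du y s t)
       (partial Dv y s t) (partial Du M s t) (partial Dv M s t)) ->
  C0_domain u v ->
  let p := fst (y 0 0) in let m := fst (M 0 0) in
  let pu := fst (partial Du y 0 0) in
  fst (y u v) = lin_comb (/ cos u) p (sin u / cos u * cos v) pu
                  (- (sin u / cos u * sin v)) m /\
  fst (M u v) = lin_comb 0 p (cos u * sin v) pu (cos u * cos v) m /\
  snd (y u v) = v + snd (y 0 0).
Proof.
  intros hy hM hrel hU; cbv zeta.
  assert (h : forall s t, C0_domain s t ->
    is_derive3 (fun s' => fst (y s' t)) s (fst (partial Du y s t)) /\
    is_derive3 (fun t' => fst (y s t')) t
      (lin_comb 0 zero 0 zero (- sin s / cos s ^ 2) (fst (M s t))) /\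
    is_derive3 (fun s' => fst (partial Du y s' t)) s
      (lin_comb (/ cos s ^ 2) (fst (y s t)) (sin s / cos s)
         (fst (partial Du y s t)) 0 zero) /\
    is_derive3 (fun t' => fst (partial Du y s t')) t
      (lin_comb 0 zero 0 zero (- / cos s ^ 3) (fst (M s t))) /\
    is_derive3 (fun s' => fst (M s' t)) s
      (lin_comb 0 zero 0 zero (- sin s / cos s) (fst (M s t))) /\
    is_derive3 (fun t' => fst (M s t')) t
      (lin_comb (- sin s) (fst (y s t)) (cos s) (fst (partial Du y s t))
         0 zero)).
  { intros s t hst.
    destruct (conjugate_structure_equations y M s t hy hM hrel hst)
      as (_ & e1 & e2 & e3 & e4 & e5).
    assert (hz : forall r b w, lin_comb 0 zero 0 zero r w
                   = lin_comb 0 (fst (y s t)) 0 b r w).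
    { intros; apply L3_eq; rewrite ?c0_lin_comb, ?c1_lin_comb, ?c2_lin_comb;
        ring. }
    assert (hz' : forall r a q b w, lin_comb r a q b 0 zero
                   = lin_comb r a q b 0 w).
    { intros; apply L3_eq; rewrite ?c0_lin_comb, ?c1_lin_comb, ?c2_lin_comb;
        ring. }
    rewrite !(hz _ (fst (partial Du y s t))), !(hz' _ _ _ _ (fst (M s t))).
    rewrite <- e1, <- e2, <- e3, <- e4, <- e5.
    pose proof (smooth_map_Du _ y hy) as hyu.
    exact (conj (smooth_map_derive_u _ y s t hy hst)
      (conj (smooth_map_derive_v _ y s t hy hst)
      (conj (smooth_map_derive_u _ _ s t hyu hst)
      (conj (smooth_map_derive_v _ _ s t hyu hst)
      (conj (smooth_map_derive_u _ M s t hM hst)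
            (smooth_map_derive_v _ M s t hM hst)))))). }
  (* [k] stands for any of the three coordinates; only linearity and compatibility with derivatives
     enter. *)
  assert (sol : forall k : L3 -> R,
    (forall r a s b t c, k (lin_comb r a s b t c) = r * k a + s * k b + t * k c) ->
    (forall a t X, is_derive3 a t X -> is_derive (fun s => k (a s)) t (k X)) ->
    k (fst (y u v)) = k (lin_comb (/ cos u) (fst (y 0 0))
       (sin u / cos u * cos v) (fst (partial Du y 0 0))
       (- (sin u / cos u * sin v)) (fst (M 0 0))) /\
    k (fst (M u v)) = k (lin_comb 0 (fst (y 0 0)) (cos u * sin v)
       (fst (partial Du y 0 0)) (cos u * cos v) (fst (M 0 0)))).
  { intros k hk hd; rewrite !hk.
    apply (structure_equations_solution (fun s t => k (fst (y s t)))
      (fun s t => k (fst (partial Du y s t))) (fun s t => k (fst (M s t))));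
      [|exact hU].
    intros s t hst; destruct (h s t hst) as (d1 & d2 & d3 & d4 & d5 & d6).
    split; [|split; [|split; [|split; [|split]]]].
    - exact (hd _ _ _ d1).
    - apply is_derive_eq with (1 := hd _ _ _ d2); rewrite hk; ring.
    - apply is_derive_eq with (1 := hd _ _ _ d3); rewrite hk; ring.
    - apply is_derive_eq with (1 := hd _ _ _ d4); rewrite hk; ring.
    - apply is_derive_eq with (1 := hd _ _ _ d5); rewrite hk; ring.
    - apply is_derive_eq with (1 := hd _ _ _ d6); rewrite hk; ring. }
  destruct (sol c0 c0_lin_comb (fun a t X d => proj1 d)) as [s0 t0].
  destruct (sol c1 c1_lin_comb (fun a t X d => proj1 (proj2 d))) as [s1 t1].
  destruct (sol c2 c2_lin_comb (fun a t X d => proj2 (proj2 d))) as [s2 t2].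
  split; [now apply L3_eq|]; split; [now apply L3_eq|].
  (* The height has partials 0 and 1, so subtracting $v$ leaves a constant. *)
  assert (hc : snd (y u v) - v = snd (y 0 0) - 0); [|lra].
  apply (constant_on_strip (fun s t => snd (y s t) - t)); [|exact hU].
  intros s t hst; destruct hy as (_ & _ & _ & hy3).
  destruct (smooth_ex_derive _ _ s t hy3 hst) as [xu xv].
  apply Derive_correct in xu; apply Derive_correct in xv.
  pose proof (rel_tu _ _ _ _ _ _ _ (hrel s t hst)) as eu.
  pose proof (rel_tv _ _ _ _ _ _ _ (hrel s t hst)) as ev.
  split.
  - apply is_derive_eq with
      (1 := is_derive_minus _ _ s _ _ xu (is_derive_const t s)).
    change (Du (fun s t => snd (y s t)) s t + - 0 = 0).
    change (Du (fun s t => snd (y s t)) s t = 0) in eu; lra.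
  - apply is_derive_eq with
      (1 := is_derive_minus _ _ t _ _ xv (is_derive_id t)).
    change (Dv (fun s t => snd (y s t)) s t + - 1 = 0).
    change (Dv (fun s t => snd (y s t)) s t = 1) in ev; lra.
Qed.

(** * Congruence with the helicoid *)

(** The explicit solution has the coefficients of the helicoid in the frame $(p,p_u,-m)$ at the
    origin; taking coordinates in this frame is the isometry. *)
Lemma conjugate_congruent_helicoid a b phi y M :
  maximal_profile a b phi ->
  smooth_map C0_domain y -> smooth_map C0_domain M ->
  (forall s t, C0_domain s t ->
     conjugate_relations s (y s t) (M s t) (partial Du y s t)
       (partial Dv y s t) (partial Du M s t) (partial Dv M s t)) ->
  congruent_surfaces C0_domain y M
    (helicoid_domain a b) (helicoid phi) (helicoid_normal phi).
Proof.
  intros hphi hy hM hrel.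
  pose proof (hrel 0 0 C0_domain_origin) as h0.
  destruct (conjugate_structure_equations y M 0 0 hy hM hrel C0_domain_origin)
    as (hpu & hpv & _).
  assert (sol := fun u v => conjugate_immersion_explicit y M u v hy hM hrel).
  cbv zeta in sol.
  destruct h0 as [[hpp hp0] huu _ hsu hsv hsm hmm hmp hmu _ hdet _ _].
  rewrite cos_0 in huu, hmm; rewrite sin_0 in hsm.
  (* At the origin only $y_v$ has a vertical part, so directness of the normal reduces to the sign
     of one [det3]. *)
  assert (hd : det3 (fst (y 0 0)) (fst (partial Du y 0 0)) (fst (M 0 0)) < 0).
  { assert (e : det4 (Nbar (y 0 0)) (partial Du y 0 0) (partial Dv y 0 0)
        (M 0 0)
      = - det3 (fst (y 0 0)) (fst (partial Du y 0 0)) (fst (M 0 0))); [|lra].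
    unfold det4; rewrite hsu, hsv, hsm; unfold Nbar; cbn [fst snd]; ring. }
  clear hdet hpv hsu hsv hsm.
  set (p := fst (y 0 0)) in *; set (m := fst (M 0 0)) in *.
  set (pu := fst (partial Du y 0 0)) in *; set (t0 := snd (y 0 0)) in *.
  clearbody p m pu t0.
  (* Reversing $m$ makes the frame direct, and [- t0] brings the height to $v$. The
     reparametrization is the identity, both surfaces living on the same strip. *)
  exists (frame_coordinates p pu (scal (-1) m)), (- t0),
    (fun u _ => u), (fun _ v => v).
  split; [|split].
  - apply frame_coordinates_isometry.
    + unfold lorentz_frame.
      rewrite !lorentz_opp_r, lorentz_opp_l, (lorentz_comm p m),
        (lorentz_comm pu m), huu, hmm, hmp, hmu, hpp, hpu.
      repeat split; field.
    + exact hp0.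
    + replace (det3 _ _ _) with (- det3 p pu m); [lra|].
      destruct m as [[? ?] ?]; unfold det3; to_reals; ring.
  - destruct (maximal_profile_interval a b phi hphi) as [-> ->].
    assert (hs1 : smooth C0_domain (fun u _ => u))
      by now apply (smooth_eval U_).
    assert (hs2 : smooth C0_domain (fun _ v => v))
      by now apply (smooth_eval V_).
    split; [exact hs1|]; split; [exact hs2|]; split; [trivial|].
    exists (fun u _ => u), (fun _ v => v).
    split; [exact hs1|]; split; [exact hs2|]; repeat split; trivial; apply H.
  - intros u v hU; pose proof (cos_strip_pos u v hU) as hc.
    destruct (maximal_profile_values a b phi u v hphi hU) as (e1 & e2 & e3).
    destruct (sol u v hU) as (s1 & s2 & s3).
    pose proof (rel_angle _ _ _ _ _ _ _ (hrel u v hU)) as s4.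
    unfold helicoid, helicoid_normal, act, d_act, frame_coordinates.
    rewrite e1, e2, e3, s1, s2, s3, s4, !lorentz_opp_l, !lorentz_lin_comb,
      (lorentz_comm pu p), (lorentz_comm pu m), (lorentz_comm p m),
      huu, hmm, hmp, hmu, hpp, hpu.
    split; apply vector_eq; unfold c0, c1, c2; cbn [fst snd]; field; lra.
Qed.

Theorem proposition4p20 (a b : Rbar) (phi : R -> R)
    (hphi : maximal_profile a b phi) :
  is_conjugate_surface C0_domain C0
    (helicoid_domain a b) (helicoid phi) (helicoid_normal phi).
Proof.
  split.
  - exists C0_normal, H1, H1_normal; exact C0_H1_conjugate.
  - intros N y M h.
    pose proof (C0_conjugate_data N y M h) as hD.
    destruct h as (_ & hy & _).
    assert (hrel := fun s t => conjugate_relations_of_data y M s t hy hD).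
    destruct hy as (hy & (hM & _) & _).
    now apply conjugate_congruent_helicoid.
Qed.
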